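(* There exist at least four pairwise non-isomorphic $\mathrm{EA}(3^5)$-additive $(121,4,1)$-designs.
   Context: A $(v,k,1)$-design is a pair $(V,\mathcal{B})$ with $V$ a $v$-set and $\mathcal{B}$ a collection of $k$-subsets (blocks) such that every pair of distinct points lies in exactly one block. $\mathrm{EA}(3^5)$ is the elementary abelian group of order $3^5$ (the additive group of $\mathbb{F}_{3^5}$). A design is $\mathrm{EA}(3^5)$-additive if, up to isomorphism, its points are elements of $\mathrm{EA}(3^5)$ and every block sums to $0$ there. Two designs are isomorphic if there is a bijection between their point sets mapping blocks onto blocks. *)

(* Defs.v *)
From mathcomp Require Import all_boot all_order all_fingroup all_algebra.

Set Implicit Arguments.
Unset Strict Implicit.
Unset Printing Implicit Defensive.

Import GRing.Theory.
Local Open Scope ring_scope.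

(* A set of blocks suffices: since two points lie in exactly one block, blocks
   cannot be repeated when k >= 2. *)
Definition is_design (v k : nat) (V : finType) (B : {set {set V}}) : Prop :=
  [/\ #|V| = v,
      forall b : {set V}, b \in B -> #|b| = k
    & forall x y : V, x != y ->
        exists! b : {set V}, [/\ b \in B, x \in b & y \in b]].

Definition isomorphic (V W : finType) (B : {set {set V}}) (C : {set {set W}}) :
    Prop :=
  exists2 f : V -> W, bijective f & [set f @: b | b : {set V} in B] = C.

Definition additive (G : finZmodType) (V : finType) (B : {set {set V}}) : Prop :=
  exists (P : {set G}) (C : {set {set {x : G | x \in P}}}),
    isomorphic B C /\
    forall c : {set {x : G | x \in P}}, c \in C -> \sum_(x in c) val x = 0.

(* Meant for prime p; 'F_p is otherwise the field of the least prime factor. *)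
Definition EA (p n : nat) : finZmodType := 'rV['F_p]_n.

(* Main.v *)
From Stdlib Require Import NArith FMapPositive Lia.
Require Import Defs.
From mathcomp Require Import all_boot all_order all_fingroup all_algebra.
From mathcomp Require Import zify.

(** The nonzero squares of F_{3^5} form a cyclic group of order 121, identified
    with Z_121 through a generator.  We give four (Z_121, 4, 1) difference
    families, invariant under the Frobenius multiplier 3, whose base blocks have
    zero sum as sets of squares; since translating a block multiplies its sum by
    a square, all blocks of the developed cyclic designs have zero sum.  The
    designs are told apart by the number, at any point x, of pairs (p, q) not
    collinear with x such that the line pq meets exactly two of the four lines
    joining a further point of xp to a further point of xq.  This number is the
    same at all points of a cyclic design; it is 0, 30, 120 and 60 (the first
    design is PG(4,3), where all four lines meet pq). *)

Set Implicit Arguments.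
Unset Strict Implicit.
Unset Printing Implicit Defensive.

Section CyclicDesigns.

Import GRing.Theory.
Local Open Scope ring_scope.

(** * Counting crossings: an isomorphism invariant *)

Definition on_line (V : finType) (B : {set {set V}}) (x y z : V) : bool :=
  (x != y) && [exists b in B, [&& x \in b, y \in b & z \in b]].

(** By the Veblen-Young axiom this is 4 for every non-collinear triple of a projective space with
    four points on each line; smaller values measure the failure of that axiom. *)
Definition crossings (V : finType) (B : {set {set V}}) (x p q : V) : nat :=
  \sum_(p' | on_line B x p p' && (p' \notin [:: x; p]))
  \sum_(q' | on_line B x q q' && (q' \notin [:: x; q]))
    [exists z, on_line B p q z && on_line B p' q' z].

(** Pairs with [p = x] pass the filter, but then the sum over [p'] is empty, so the crossing number
    is 0 and not 2. *)
Definition doubly_crossed (V : finType) (B : {set {set V}}) (x : V) : nat :=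
  \sum_p \sum_(q | ~~ on_line B x p q) (crossings B x p q == 2)%N.

Lemma on_line_iso (V W : finType) (B : {set {set V}}) (C : {set {set W}})
    (f : V -> W) (x y z : V) :
  injective f -> [set f @: b | b : {set V} in B] = C ->
  on_line C (f x) (f y) (f z) = on_line B x y z.
Proof.
move=> f_inj defC; rewrite /on_line (inj_eq f_inj); congr (_ && _).
apply/exists_inP/exists_inP => [[c] | [b bB xyz]].
  by rewrite -defC => /imsetP[b bB ->]; rewrite !(mem_imset _ _ f_inj);
    exists b.
by exists (f @: b); [rewrite -defC imset_f|rewrite !(mem_imset _ _ f_inj)].
Qed.

Lemma crossings_iso (V W : finType) (B : {set {set V}}) (C : {set {set W}})
    (f : V -> W) (x p q : V) :
  bijective f -> [set f @: b | b : {set V} in B] = C ->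
  crossings C (f x) (f p) (f q) = crossings B x p q.
Proof.
move=> f_bij defC; have f_inj := bij_inj f_bij.
have lineE := on_line_iso _ _ _ f_inj defC.
rewrite /crossings (reindex f) /=; last exact: onW_bij.
apply: eq_big => [p'|p' _]; first by rewrite lineE !inE !(inj_eq f_inj).
rewrite (reindex f) /=; last exact: onW_bij.
apply: eq_big => [q'|q' _]; first by rewrite lineE !inE !(inj_eq f_inj).
congr (nat_of_bool _); apply/existsP/existsP => [[z]|[z zP]]; last first.
  by exists (f z); rewrite !lineE.
have [g _ fgK] := f_bij; rewrite -(fgK z) !lineE => zP.
by exists (g z).
Qed.

Lemma doubly_crossed_iso (V W : finType) (B : {set {set V}}) (C : {set {set W}})
    (f : V -> W) (x : V) :
  bijective f -> [set f @: b | b : {set V} in B] = C ->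
  doubly_crossed C (f x) = doubly_crossed B x.
Proof.
move=> f_bij defC.
rewrite /doubly_crossed (reindex f) /=; last exact: onW_bij.
apply: eq_bigr => p _; rewrite (reindex f) /=; last exact: onW_bij.
apply: eq_big => [q|q _];
  first by rewrite (on_line_iso _ _ _ (bij_inj f_bij) defC).
by rewrite (crossings_iso _ _ _ f_bij defC).
Qed.

(** * Binary arithmetic modulo 121 *)

(* Residues modulo 121 are represented in binary, since the designs have to be
   evaluated by the kernel and 'Z_121 computes in unary. *)
Definition add121 (a b : N) : N :=
  let s := (a + b)%num in if (s <? 121)%num then s else (s - 121)%num.

(** For [b = 0] the second summand is 121 itself, which the single reduction in [add121] still
    removes. *)
Definition sub121 (a b : N) : N := add121 a (121 - b)%num.

Definition residues : seq N := [seq N.of_nat n | n <- iota 0 121].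

Definition phi (n : N) : 'Z_121 := (N.to_nat n)%:R.

Lemma residues_uniq : uniq residues.
Proof. by rewrite map_inj_uniq ?iota_uniq //;
  apply: (can_inj Nnat.Nat2N.id). Qed.

Lemma mem_residues (a : N) : (a \in residues) = (N.to_nat a < 121)%N.
Proof.
apply/mapP/idP => [[n n_in ->]|a_lt].
  by move: n_in; rewrite mem_iota; lia.
by exists (N.to_nat a); rewrite ?mem_iota ?Nnat.N2Nat.id.
Qed.

Lemma add121_residue (a b : N) :
  a \in residues -> b \in residues -> add121 a b \in residues.
Proof.
rewrite !mem_residues /add121 => a_lt b_lt.
by case: N.ltb_spec; lia.
Qed.

Lemma sub121_residue (a b : N) :
  a \in residues -> b \in residues -> sub121 a b \in residues.
Proof.
rewrite !mem_residues /sub121 /add121 => a_lt b_lt.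
by case: N.ltb_spec; lia.
Qed.

Lemma phiD (a b : N) : phi (add121 a b) = phi a + phi b.
Proof.
rewrite /phi /add121 -natrD; case: N.ltb_spec => ab;
  first by rewrite Nnat.N2Nat.inj_add.
rewrite -[RHS]subr0 -(@pchar_Zp 121 isT) -natrB; last lia.
by congr _%:R; lia.
Qed.

Lemma phiB (a b : N) : b \in residues -> phi (sub121 a b) = phi a - phi b.
Proof.
rewrite mem_residues => b_lt; rewrite /sub121 phiD; congr (_ + _).
rewrite -[RHS]add0r -(@pchar_Zp 121 isT) /phi -natrB; last lia.
by congr _%:R; lia.
Qed.

Lemma val_phi (a : N) : a \in residues -> phi a = N.to_nat a :> nat.
Proof. by rewrite mem_residues /phi val_Zp_nat // => /modn_small. Qed.

Lemma phi_inj : {in residues &, injective phi}.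
Proof.
move=> a b aR bR /(congr1 val) /=.
by rewrite !val_phi // => /Nnat.N2Nat.inj.
Qed.

Lemma phi_onto (x : 'Z_121) : exists2 a, a \in residues & x = phi a.
Proof.
exists (N.of_nat x); last by rewrite /phi Nnat.Nat2N.id natr_Zp.
by rewrite mem_residues Nnat.Nat2N.id; apply: (ltn_ord x).
Qed.

Lemma sum_phi (P : pred 'Z_121) (F : 'Z_121 -> nat) :
  (\sum_(x | P x) F x = \sum_(a <- residues | P (phi a)) F (phi a))%N.
Proof.
rewrite -(big_map phi P F); apply: perm_big.
apply: uniq_perm => [||x]; first exact: index_enum_uniq.
  by rewrite (map_inj_in_uniq phi_inj) residues_uniq.
by rewrite mem_index_enum; have [a aR ->] := phi_onto x; rewrite map_f.
Qed.

(** * Cyclic designs from difference families *)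

Definition translate (X : seq N) (t : 'Z_121) : {set 'Z_121} :=
  [set x in [seq phi s + t | s <- X]].

Definition develop (D : seq (seq N)) : {set {set 'Z_121}} :=
  [set b | [exists t, b \in [seq translate X t | X <- D]]].

Definition flags (D : seq (seq N)) : seq (seq N * N) :=
  [seq (X, s) | X <- D, s <- X].

(* The blocks of [develop D] through 0 and d: exactly one for each nonzero d
   when [D] is a difference family. *)
Definition lines_at (D : seq (seq N)) (d : N) : seq (seq N) :=
  [seq [seq sub121 s F.2 | s <- F.1] | F <- flags D & add121 F.2 d \in F.1].

(** Stores the line through 0 and each nonzero d in a binary trie, so that evaluation does not
    search the flags again. The residue 0 is no key, which makes degenerate lines empty. *)
Definition table (D : seq (seq N)) : PositiveMap.t (seq N) :=
  foldr (fun d T => if d is Npos p then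
                      PositiveMap.add p (head [::] (lines_at D d)) T else T)
    (PositiveMap.empty _) residues.

Definition lookup (T : PositiveMap.t (seq N)) (d : N) : seq N :=
  if d is Npos p then odflt [::] (PositiveMap.find p T) else [::].

(** That [lines_at D d] is a singleton says that d is a difference exactly once. Comparing its entry
    with [lookup T d] certifies the table by the same computation and excludes the default
    values. *)
Definition difference_family (D : seq (seq N)) : bool :=
  all (fun X => [&& size X == 4%N, uniq X & all (mem residues) X]) D &&
  (let T := table D in
   all (fun d => lines_at D d == [:: lookup T d]) (behead residues)).

(* For [a = b] this is the empty list. *)
Definition line (T : PositiveMap.t (seq N)) (a b : N) : seq N :=
  [seq add121 a w | w <- lookup T (sub121 b a)].

Lemma developP (D : seq (seq N)) (b : {set 'Z_121}) :
  reflect (exists X t, X \in D /\ b = translate X t) (b \in develop D).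
Proof.
rewrite inE; apply: (iffP existsP) => [[t /mapP[X XD ->]]|[X [t [XD ->]]]].
  by exists X, t.
by exists t; apply: map_f.
Qed.

Lemma mem_translate (X : seq N) (t x : 'Z_121) :
  reflect (exists2 s, s \in X & x = phi s + t) (x \in translate X t).
Proof. by rewrite inE; apply: mapP. Qed.

Lemma mem_flags (D : seq (seq N)) (X : seq N) (s : N) :
  ((X, s) \in flags D) = (X \in D) && (s \in X).
Proof.
apply/allpairsPdep/andP => [[Y [u [YD uY [-> ->]]]] //|[XD sX]].
by exists X, s.
Qed.

Lemma sub121_neq0_residue (a b : N) : a \in residues -> b \in residues ->
  a != b -> sub121 b a \in behead residues.
Proof.
move=> aR bR ab; have := sub121_residue bR aR.
rewrite [in X in X -> _](_ : residues = 0%num :: behead residues) // inE.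
case/predU1P=> // d0; case/eqP: ab; apply: phi_inj => //.
by apply/esym/eqP; rewrite -subr_eq0 -phiB // d0.
Qed.

Lemma line_diag (T : PositiveMap.t (seq N)) (a : N) :
  a \in residues -> line T a a = [::].
Proof.
rewrite mem_residues => aR; rewrite /line; suff -> : sub121 a a = 0%num by [].
by rewrite /sub121 /add121; case: N.ltb_spec; lia.
Qed.

Section Family.
Variable D : seq (seq N).
Hypothesis D_fam : difference_family D.
Let T := table D.

Lemma family_block X :
  X \in D ->
  [/\ size X = 4%N, uniq X & forall s, s \in X -> s \in residues].
Proof.
by case/andP: D_fam => /allP h _ /h /and3P[/eqP ? ? /allP].
Qed.

Lemma lines_atE d : d \in behead residues -> lines_at D d = [:: lookup T d].
Proof. by case/andP: D_fam => _ /allP h /h /eqP. Qed.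

(** The singleton [lines_at D (b - a)] is the image of the list of flags (X, s) with s + (b - a) in
    X, so that list has exactly one element. *)
Lemma line_flag a b : a \in residues -> b \in residues -> a != b ->
  exists X s, [/\ X \in D, s \in X, add121 s (sub121 b a) \in X,
    lookup T (sub121 b a) = [seq sub121 w s | w <- X] &
    forall Y u, Y \in D -> u \in Y -> add121 u (sub121 b a) \in Y ->
      Y = X /\ u = s].
Proof.
move=> aR bR ab; have dR := sub121_neq0_residue aR bR ab.
have := lines_atE dR; set d := sub121 b a; rewrite /lines_at => E.
case defF: [seq F <- _ | _] E => [//|[X s] [|]] //= [E].
have: (X, s) \in [seq F <- flags D | add121 F.2 d \in F.1].
  by rewrite defF mem_head.
rewrite mem_filter mem_flags /= => /and3P[sdX XD sX].
exists X, s; split=> // Y u YD uY udY.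
have: (Y, u) \in [seq F <- flags D | add121 F.2 d \in F.1].
  by rewrite mem_filter mem_flags /= YD uY udY.
by rewrite defF inE => /eqP[].
Qed.

Lemma line_sub a b : a \in residues -> b \in residues ->
  {subset line T a b <= residues}.
Proof.
move=> aR bR; have [->|ab] := eqVneq a b; first by rewrite line_diag.
have [X [s [XD sX _ defL _]]] := line_flag aR bR ab.
have [_ _ XR] := family_block XD.
move=> c /mapP[w]; rewrite defL => /mapP[v vX ->] ->.
by apply: add121_residue => //; apply: sub121_residue; apply: XR.
Qed.

Lemma line_translate a b : a \in residues -> b \in residues -> a != b ->
  exists X s, [/\ X \in D, s \in X &
    [set x in map phi (line T a b)] = translate X (phi a - phi s)].
Proof.
move=> aR bR ab; have [X [s [XD sX _ defL _]]] := line_flag aR bR ab.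
exists X, s; split=> //; have [_ _ XR] := family_block XD.
rewrite /translate; suff -> : map phi (line T a b) =
  [seq phi w + (phi a - phi s) | w <- X] by [].
rewrite /line defL -!map_comp; apply/eq_in_map => w wX /=.
by rewrite phiD phiB ?XR // addrCA.
Qed.

Lemma line_in_develop a b : a \in residues -> b \in residues -> a != b ->
  [set x in map phi (line T a b)] \in develop D.
Proof.
move=> aR bR ab; have [X [s [XD sX ->]]] := line_translate aR bR ab.
by apply/developP; exists X, (phi a - phi s).
Qed.

Lemma mem_line a b : a \in residues -> b \in residues -> a != b ->
  phi a \in map phi (line T a b) /\ phi b \in map phi (line T a b).
Proof.
move=> aR bR ab; have [X [s [XD sX sbX defL _]]] := line_flag aR bR ab.
have [_ _ XR] := family_block XD.
rewrite /line defL -!map_comp; split; apply/mapP.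
  by exists s => //=; rewrite phiD phiB ?XR // subrr addr0.
exists (add121 s (sub121 b a)) => //=.
by rewrite phiD phiB ?XR // phiD phiB // [phi s + _]addrC addrK addrC subrK.
Qed.

(** If Y + t contains a = u + t and b = v + t, then u + (b - a) = v lies in Y, so (Y, u) is the
    unique flag for the difference b - a; t = a - u then gives the translate listed by [line]. *)
Lemma block_through a b c : a \in residues -> b \in residues -> a != b ->
  c \in develop D -> phi a \in c -> phi b \in c ->
  c = [set x in map phi (line T a b)].
Proof.
move=> aR bR ab /developP[Y [t [YD ->]]] /mem_translate[u uY au]
  /mem_translate[v vY bv].
have [X [s [XD sX sbX defL uniq_flag]]] := line_flag aR bR ab.
have [_ _ YR] := family_block YD.
have defv : add121 u (sub121 b a) = v.
  apply: phi_inj; [|exact: YR|].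
    by apply: add121_residue; [exact: YR | exact: sub121_residue].
  by rewrite phiD phiB // bv au opprD addrACA subrr addr0 addrCA subrr addr0.
have [|Yx us] := uniq_flag _ _ YD uY; first by rewrite defv.
subst Y u; rewrite /translate; suff -> : map phi (line T a b) =
  [seq phi w + t | w <- X] by [].
rewrite /line defL -!map_comp; apply/eq_in_map => w wX /=.
by rewrite phiD phiB ?YR // au addrCA (addrC (phi s)) addrK.
Qed.

Lemma on_line_develop a b c :
  a \in residues -> b \in residues -> c \in residues ->
  on_line (develop D) (phi a) (phi b) (phi c) = (c \in line T a b).
Proof.
move=> aR bR cR; rewrite /on_line (inj_in_eq phi_inj) //.
have [->|ab] /= := eqVneq a b; first by rewrite line_diag.
have memE : (phi c \in map phi (line T a b)) = (c \in line T a b).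
  apply/mapP/idP => [[w wL /phi_inj ->]|cL] //; last by exists c.
  exact: line_sub wL.
apply/exists_inP/idP => [[X XD /and3P[aX bX cX]]|cL].
  by move: cX; rewrite (block_through aR bR ab XD aX bX) inE memE.
exists [set x in map phi (line T a b)]; first exact: line_in_develop.
by have [aL bL] := mem_line aR bR ab; rewrite !inE aL bL memE.
Qed.

Lemma card_translate X t : X \in D -> #|translate X t| = 4%N.
Proof.
move=> XD; have [X_size X_uniq XR] := family_block XD.
rewrite cardsE; have/card_uniqP -> : uniq [seq phi s + t | s <- X].
  by rewrite map_inj_in_uniq // => u v uX vX /addIr /phi_inj; apply; exact: XR.
by rewrite size_map X_size.
Qed.

Lemma develop_design : is_design 121 4 (develop D).
Proof.
split=> [|b /developP[X [t [XD ->]]]|x y]; first exact: card_ord.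
  exact: card_translate.
have [a aR ->] := phi_onto x; have [b bR ->] := phi_onto y.
rewrite (inj_in_eq phi_inj) // => ab.
exists [set z in map phi (line T a b)]; split.
  have [aL bL] := mem_line aR bR ab.
  by split; [exact: line_in_develop | rewrite inE..].
by move=> c [cD ac bc]; rewrite (block_through aR bR ab cD ac bc).
Qed.
End Family.

(** * Translations as automorphisms *)

Lemma develop_shift (D : seq (seq N)) (u : 'Z_121) :
  [set +%R u @: b | b : {set 'Z_121} in develop D] = develop D.
Proof.
have shift X t : +%R u @: translate X t = translate X (u + t).
  apply/setP => x;
    apply/imsetP/mem_translate => [[_ /mem_translate[s sX ->] ->]|].
    by exists s; rewrite // addrCA.
  move=> [s sX ->]; exists (phi s + t); last by rewrite addrCA.
  by apply/mem_translate; exists s.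
apply/setP => b; apply/imsetP/developP => [[_ /developP[X [t [XD ->]]] ->]|].
  by exists X, (u + t); rewrite shift.
move=> [X [t [XD ->]]]; exists (translate X (t - u));
  last by rewrite shift addrC subrK.
by apply/developP; exists X, (t - u).
Qed.

Lemma doubly_crossed_develop (D : seq (seq N)) (x y : 'Z_121) :
  doubly_crossed (develop D) x = doubly_crossed (develop D) y.
Proof.
rewrite -[x](subrK y) (@doubly_crossed_iso _ _ (develop D) (develop D) (+%R (x
  - y))) //.
  by exists (+%R (- (x - y))); [exact: addKr | exact: addNKr].
exact: develop_shift.
Qed.

(** * Computing the invariant from the table *)

Definition crossings121 (T : PositiveMap.t (seq N)) (x p q : N) : nat :=
  let L := line T p q in
  sumn [seq sumn [seq has [in L] (line T p' q') : nat
                | q' <- line T x q & q' \notin [:: x; q]]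
      | p' <- line T x p & p' \notin [:: x; p]].

Definition doubly_crossed121 (T : PositiveMap.t (seq N)) (x : N) : nat :=
  sumn [seq (let L := line T x p in
             count (fun q => (q \notin L) && (crossings121 T x p q == 2%N))
               residues)
       | p <- residues].

Section Count.
Variable D : seq (seq N).
Hypothesis D_fam : difference_family D.
Let T := table D.

Lemma line_uniq a b : a \in residues -> b \in residues -> uniq (line T a b).
Proof.
move=> aR bR; have [->|ab] := eqVneq a b; first by rewrite line_diag.
(* The image under [phi] is a translate of a base block, hence a set of 4 points, and the list has
   length 4. *)
apply: (@map_uniq _ _ phi); apply/card_uniqP.
have [X [s [XD sX defL]]] := line_translate D_fam aR bR ab.
rewrite -cardsE defL (card_translate D_fam) // size_map.
have [Y [u [YD uY _ defT _]]] := line_flag D_fam aR bR ab.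
have [sizeY _ _] := family_block D_fam YD.
by rewrite /line size_map defT size_map.
Qed.

Lemma sum_line a b (P : pred 'Z_121) (F : 'Z_121 -> nat) :
  a \in residues -> b \in residues ->
  (\sum_(z | on_line (develop D) (phi a) (phi b) z && P z) F z
   = sumn [seq F (phi c) | c <- line T a b & P (phi c)])%N.
Proof.
move=> aR bR; rewrite sum_phi sumnE big_map.
rewrite -big_filter -[RHS]big_filter; apply: perm_big; apply: uniq_perm.
- by rewrite filter_uniq // residues_uniq.
- by rewrite !filter_uniq // line_uniq.
move=> c; rewrite !mem_filter andTb; have [cR|cR] := boolP (c \in residues).
  by rewrite on_line_develop // andbT andbC.
rewrite andbF; apply/esym/negP => /andP[_ /(line_sub D_fam aR bR)].
exact/negP.
Qed.

Lemma crossings_develop x p q :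
  x \in residues -> p \in residues -> q \in residues ->
  crossings (develop D) (phi x) (phi p) (phi q) = crossings121 T x p q.
Proof.
move=> xR pR qR; rewrite /crossings sum_line //; congr sumn.
have notinE r a : r \in residues -> a \in residues ->
  (phi r \notin [:: phi x; phi a]) = (r \notin [:: x; a]).
  by move=> rR aR; rewrite !inE !(inj_in_eq phi_inj).
have -> : [seq c <- line T x p | phi c \notin [:: phi x; phi p]] =
          [seq c <- line T x p | c \notin [:: x; p]].
  by apply/eq_in_filter => c /(line_sub D_fam xR pR) cR; rewrite notinE.
apply/eq_in_map => p';
  rewrite mem_filter => /andP[_ /(line_sub D_fam xR pR) p'R].
rewrite sum_line //; congr sumn.
have -> : [seq c <- line T x q | phi c \notin [:: phi x; phi q]] =
          [seq c <- line T x q | c \notin [:: x; q]].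
  by apply/eq_in_filter => c /(line_sub D_fam xR qR) cR; rewrite notinE.
apply/eq_in_map => q';
  rewrite mem_filter => /andP[_ /(line_sub D_fam xR qR) q'R].
congr nat_of_bool; apply/existsP/hasP => [[z]|[c cL' cL]].
  by have [c cR ->] := phi_onto z; rewrite !on_line_develop // => /andP[];
    exists c.
exists (phi c); have cR := line_sub D_fam p'R q'R cL'.
by rewrite !on_line_develop //; apply/andP.
Qed.

Lemma doubly_crossed_phi x : x \in residues ->
  doubly_crossed (develop D) (phi x) = doubly_crossed121 T x.
Proof.
move=> xR; rewrite /doubly_crossed sum_phi /doubly_crossed121 sumnE big_map.
apply: eq_big_seq => p pR.
rewrite sum_phi big_mkcond -sum1_count [RHS]big_mkcond;
  apply: eq_big_seq => q qR.
rewrite on_line_develop // crossings_develop //.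
by case: (q \notin _); case: (_ == _).
Qed.
End Count.

(** * Squares of the field of order 243 and zero sums *)

(* Multiplication by [x] on the coefficient lists of F_3[x] / (x^5 - x - 2). *)
Definition mulx (v : seq nat) : seq nat :=
  let c := last 0%N v in
  if belast 0%N v is [:: _, a & w] then [:: (2 * c) %% 3, (a + c) %% 3 & w]%N
  else v.

(** The entry at index n is x^(2n), so adding indices modulo 121 multiplies squares. *)
Definition squares : seq (seq nat) :=
  traject (mulx \o mulx) [:: 1; 0; 0; 0; 0]%N 121.

Definition coord (n j : nat) : nat := nth 0%N (nth [::] squares n) j.

Definition point (i : 'Z_121) : EA 3 5 := \row_j (coord i j)%:R.

Lemma natr_F3_eq0 (n : nat) : (n%:R == 0 :> 'F_3) = (3 %| n)%N.
Proof. by rewrite -(dvdn_pcharf (pchar_Fp (isT : prime 3))). Qed.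

(** The 121 coefficient lists are distinct with entries below 3, so reduction modulo 3 loses
    nothing. *)
Lemma point_inj : injective point.
Proof.
have small : all (fun v => (size v == 5) && all (gtn 3) v)%N squares by
  vm_compute.
have uniq_sq : uniq squares by vm_compute.
have lt_sq (l : 'Z_121) : (l < size squares)%N.
  by rewrite /squares size_traject; exact: ltn_ord.
have sq_nth (l : 'Z_121) : nth [::] squares l \in squares by exact: mem_nth.
move=> i k eq_ik; suff /eqP: nth [::] squares i = nth [::] squares k.
  by rewrite (nth_uniq [::] (lt_sq i) (lt_sq k) uniq_sq) => /eqP/val_inj.
have := allP small _ (sq_nth k); have := allP small _ (sq_nth i).
have : forall j : 'I_5, coord i j = coord k j %[mod 3].
  move=> j; have := congr1 (fun v : 'rV_5 => val (v 0 j)) eq_ik.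
  by rewrite !mxE /= !val_Fp_nat.
rewrite /coord; move: (nth [::] squares i) (nth [::] squares k) => v w eq_vw.
move=> /andP[/eqP size_v lt_v] /andP[/eqP size_w lt_w] {small uniq_sq lt_sq
  sq_nth}.
apply: (@eq_from_nth _ 0%N) => [|j]; rewrite size_v ?size_w // => lt_j5.
have := eq_vw (Ordinal lt_j5); rewrite /= !modn_small //.
  by apply: (allP lt_w); rewrite mem_nth ?size_w.
by apply: (allP lt_v); rewrite mem_nth ?size_v.
Qed.

(** Every translate of every base block is tested coordinatewise; this replaces the argument that a
    translation multiplies the sum by a square. *)
Definition zero_sum (D : seq (seq N)) : bool :=
  all (fun X => all (fun t => all (fun j =>
    (3 %| sumn [seq coord (N.to_nat (add121 s t)) j | s <- X])%N)
  (iota 0 5)) residues) D.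

Lemma additive_develop (D : seq (seq N)) :
  difference_family D -> zero_sum D -> Defs.additive (EA 3 5) (develop D).
Proof.
move=> D_fam /allP D_zero; pose P := [set point i | i : 'Z_121].
have pointP i : point i \in P by apply: imset_f.
pose f i : {x | x \in P} := exist _ (point i) (pointP i).
have f_inj : injective f by move=> i k /(congr1 val) /point_inj.
exists P, [set f @: b | b : {set 'Z_121} in develop D]; split.
  exists f => //; apply: inj_card_bij => //.
  by rewrite card_sig -(card_imset _ point_inj) leq_eqVlt;
    apply/orP/or_introl/eqP/eq_card => x; rewrite inE.
move=> _ /imsetP[b bD ->]; rewrite big_imset /=; last exact: in2W.
have /developP[X [t [XD ->]]] := bD; have [a aR ->] := phi_onto t.
have [_ X_uniq XR] := family_block D_fam XD.
rewrite (eq_bigl [in [seq phi s + phi a | s <- X]]) => [|x];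
  last by rewrite inE.
rewrite -big_uniq /=; last first.
  by rewrite map_inj_in_uniq // => u v uX vX /addIr /phi_inj; apply; exact: XR.
rewrite big_map; apply/rowP => j; rewrite summxE mxE.
(* The exponents in the block are s + a for s in X, so the test for X, a and j is the j-th
   coordinate of the sum. *)
have /allP/(_ _ aR)/allP/(_ j) := D_zero _ XD.
rewrite mem_iota ltn_ord => /(_ isT);
  rewrite -natr_F3_eq0 sumnE big_map natr_sum.
move=> /eqP sum0; apply: etrans sum0; apply: eq_big_seq => s sX.
by rewrite mxE -phiD val_phi // add121_residue // XR.
Qed.

(** * The four families and their separation *)

(* Closure under the Frobenius map, which acts on exponents as multiplication
   by 3, of order 5 modulo 121. *)
Definition frobenius_closure (l : seq (seq N)) : seq (seq N) :=
  [seq [seq (m * s) mod 121 | s <- X] | m <- [:: 1; 3; 9; 27; 81], X <- l]%num.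

(** Two blocks and five multipliers give 10 base blocks with 10 * 12 = 120 differences, one for each
    nonzero residue. *)
Definition families : seq (seq (seq N)) :=
  map frobenius_closure
    [:: [:: [:: 0; 1; 36; 102]; [:: 0; 2; 10; 17]];
        [:: [:: 0; 1; 65; 78]; [:: 0; 2; 25; 116]];
        [:: [:: 0; 4; 15; 78]; [:: 0; 1; 52; 93]];
        [:: [:: 0; 4; 79; 95]; [:: 0; 1; 21; 55]]]%num.

Definition counts : seq nat := [:: 0; 30; 120; 60]%N.

Lemma families_additive :
  all (fun D => difference_family D && zero_sum D) families.
Proof. by vm_compute. Qed.

(** Evaluation at the point 0 suffices, since translations are transitive on points. *)
Lemma families_counts :
  [seq doubly_crossed121 (table D) 0%num | D <- families] = counts.
Proof. by vm_compute. Qed.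

Definition family (i : 'I_4) : seq (seq N) := nth [::] families i.

Lemma familyP (i : 'I_4) : difference_family (family i) /\ zero_sum (family i).
Proof.
by apply/andP; apply: (allP families_additive); rewrite mem_nth // ltn_ord.
Qed.

Lemma doubly_crossed_family (i : 'I_4) (x : 'Z_121) :
  doubly_crossed (develop (family i)) x = nth 0%N counts i.
Proof.
have [i_fam _] := familyP i.
rewrite (doubly_crossed_develop _ x (phi 0%num)) doubly_crossed_phi //.
by rewrite -families_counts (nth_map [::]) ?ltn_ord.
Qed.

Lemma family_not_isomorphic (i j : 'I_4) :
  i != j -> ~ isomorphic (develop (family i)) (develop (family j)).
Proof.
(* The point 0 is an arbitrary choice: the invariant is constant on each design, and the four counts
   are distinct. *)
move=> ij [f f_bij fE]; have := doubly_crossed_iso 0 f_bij fE.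
rewrite !doubly_crossed_family => /eqP.
by rewrite nth_uniq ?ltn_ord // eq_sym; apply/negP.
Qed.

End CyclicDesigns.

Theorem theorem4p1 :
  exists (V : 'I_4 -> finType) (B : forall i : 'I_4, {set {set V i}}),
    [/\ forall i : 'I_4, is_design 121 4 (B i),
        forall i : 'I_4, additive (EA 3 5) (B i)
      & forall i j : 'I_4, i != j -> ~ isomorphic (B i) (B j)].
Proof.
exists (fun=> 'Z_121 : finType), (fun i => develop (family i)); split=> [i|i|].
- by have [/develop_design] := familyP i.
- by have [/additive_develop] := familyP i; apply.
exact: family_not_isomorphic.
Qed.
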